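(* Let $G$ be a highly transitive countable group. Then exactly one of the following two mutually exclusive conditions holds. (a) $G$ contains a normal subgroup isomorphic to $Alt(\mathbb N)$. (b) $G$ is mixed identity free (equivalently, $G$ and $G\ast F_n$ are universally equivalent as $G$-groups for every $n\in\mathbb N$).
   Context: An action of a group $G$ on a set $\Omega$ is $k$-transitive if $|\Omega|\ge k$ and for any two $k$-tuples of distinct elements $(a_1,\dots,a_k)$, $(b_1,\dots,b_k)$ of $\Omega$ there is $g\in G$ with $ga_i=b_i$ for all $i$; it is highly transitive if it is $k$-transitive for all $k\in\mathbb N$. A group is highly transitive if it admits a highly transitive faithful action. $Alt(\mathbb N)$ is the group of all permutations of $\mathbb N$ with finite support that act as even permutations on their supports. Let $F_n$ be the free group of rank $n$. A group $G$ satisfies a mixed identity $w=1$, $w\in G\ast F_n$, if every homomorphism $G\ast F_n\to G$ that is the identity on $G$ sends $w$ to $1$; the mixed identity is non-trivial if $w\ne1$ in $G\ast F_n$. $G$ is mixed identity free (MIF) if it satisfies no non-trivial mixed identity (for any $n$). A $G$-group is a group $H$ with a fixed embedding $G\le H$. Two $G$-groups are universally equivalent as $G$-groups if they satisfy the same universal first order sentences in the language of groups with constants for the elements of $G$. *)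

(* Defs.v *)
From HB Require Import structures.
From mathcomp Require Import all_boot all_fingroup.
From mathcomp Require Import generic_quotient finmap.
From mathcomp Require Import boolp classical_sets functions cardinality.

Set Implicit Arguments.
Unset Strict Implicit.
Unset Printing Implicit Defensive.

Local Open Scope quotient_scope.
Local Open Scope group_scope.

(* Groups given by generators and relations: words in the alphabet A, where
   inv a is the formal inverse of the letter a, modulo the monoid congruence
   generated by a * inv a = 1 = inv a * a and the relations u = v of rel. *)
Section Presentation.
Variables (A : choiceType) (inv : A -> A) (rel : seq A -> seq A -> Prop).

Inductive cong : seq A -> seq A -> Prop :=
| cong_rel u v : rel u v -> cong u v
| cong_invr a : cong [:: a; inv a] [::]
| cong_invl a : cong [:: inv a; a] [::]
| cong_refl u : cong u u
| cong_sym u v : cong u v -> cong v u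
| cong_trans u v w : cong u v -> cong v w -> cong u w
| cong_cat u u' v v' : cong u u' -> cong v v' -> cong (u ++ v) (u' ++ v').

Definition congb u v := `[< cong u v >].

Lemma congb_refl : reflexive congb.
Proof. by move=> u; apply/asboolP/cong_refl. Qed.

Lemma congb_sym : symmetric congb.
Proof. by move=> u v; apply/asboolP/asboolP => /cong_sym. Qed.

Lemma congb_trans : transitive congb.
Proof.
by move=> v u w /asboolP uv /asboolP vw; apply/asboolP/(cong_trans uv vw).
Qed.

Canonical congb_equiv := EquivRel congb congb_refl congb_sym congb_trans.

Definition presented := {eq_quot congb}.
HB.instance Definition _ := Choice.on presented.

Definition pres_class (u : seq A) : presented := \pi_{eq_quot congb}%qT u.
Definition pres_word (x : presented) : seq A := repr (x : {eq_quot congb}).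

Lemma pres_wordK : cancel pres_word pres_class.
Proof. exact: reprK. Qed.

Lemma pres_classP u v : pres_class u = pres_class v <-> cong u v.
Proof. by split=> [/eqmodP/asboolP|uv]; last exact/eqmodP/asboolP. Qed.

Lemma pres_class_word u : cong (pres_word (pres_class u)) u.
Proof. by apply/pres_classP; rewrite pres_wordK. Qed.

Definition pres_one := pres_class [::].
Definition pres_mul x y := pres_class (pres_word x ++ pres_word y).
Definition pres_inv x := pres_class (rev (map inv (pres_word x))).

Lemma pres_mulA : associative pres_mul.
Proof.
move=> x y z; apply/pres_classP.
apply: (@cong_trans _ (pres_word x ++ pres_word y ++ pres_word z)).
  by apply: cong_cat; [exact: cong_refl | exact: pres_class_word].
rewrite catA; apply: cong_sym.
by apply: cong_cat; [exact: pres_class_word | exact: cong_refl].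
Qed.

Lemma pres_mul1 : left_id pres_one pres_mul.
Proof.
move=> x; rewrite -[RHS]pres_wordK; apply/pres_classP.
rewrite -[X in cong _ X]cat0s.
by apply: cong_cat; [exact: pres_class_word | exact: cong_refl].
Qed.

Lemma pres_mulr1 : right_id pres_one pres_mul.
Proof.
move=> x; rewrite -[RHS]pres_wordK; apply/pres_classP.
rewrite -[X in cong _ X]cats0.
by apply: cong_cat; [exact: cong_refl | exact: pres_class_word].
Qed.

Lemma pres_mulV : left_inverse pres_one pres_inv pres_mul.
Proof.
move=> x; apply/pres_classP.
apply: (@cong_trans _ (rev (map inv (pres_word x)) ++ pres_word x)).
  by apply: cong_cat; [exact: pres_class_word | exact: cong_refl].
elim: (pres_word x) => [|a u IH]; first exact: cong_refl.
rewrite /= rev_cons cat_rcons -cat1s -[a :: u]cat1s [X in _ ++ X]catA.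
apply: cong_trans IH; apply: cong_cat; first exact: cong_refl.
rewrite -[X in cong _ X]cat0s.
by apply: cong_cat; [exact: cong_invl | exact: cong_refl].
Qed.

Lemma pres_mulrV : right_inverse pres_one pres_inv pres_mul.
Proof.
move=> x; apply/pres_classP.
apply: (@cong_trans _ (pres_word x ++ rev (map inv (pres_word x)))).
  by apply: cong_cat; [exact: cong_refl | exact: pres_class_word].
elim: (pres_word x) => [|a u IH]; first exact: cong_refl.
rewrite /= rev_cons -rcons_cat -cat1s -cats1.
apply: (@cong_trans _ ([:: a] ++ [::] ++ [:: inv a])); last exact: cong_invr.
apply: cong_cat; first exact: cong_refl.
by apply: cong_cat => //; exact: cong_refl.
Qed.

HB.instance Definition _ := isGroup.Build presented
  pres_mulA pres_mul1 pres_mulr1 pres_mulV pres_mulrV.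

Lemma pres_class_cat u v : pres_class (u ++ v) = pres_class u * pres_class v.
Proof.
by apply/pres_classP/cong_sym; apply: cong_cat; exact: pres_class_word.
Qed.

Definition pres_letter (a : A) : presented := pres_class [:: a].

Lemma pres_class_prod u : pres_class u = \prod_(a <- u) pres_letter a.
Proof.
by elim: u => [|a u IH]; rewrite ?big_nil // big_cons -IH -pres_class_cat.
Qed.

Lemma pres_rel u v : rel u v ->
  \prod_(a <- u) pres_letter a = \prod_(a <- v) pres_letter a.
Proof. by move=> uv; rewrite -!pres_class_prod; exact/pres_classP/cong_rel. Qed.

Lemma pres_letterV a : pres_letter (inv a) = (pres_letter a)^-1.
Proof.
apply: (mulIg (pres_letter a)); rewrite mulVg -pres_class_cat.
exact/pres_classP/cong_invl.
Qed.

Section Lift.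
Variables (K : groupType) (f : A -> K).
Hypothesis fV : forall a, f (inv a) = (f a)^-1.
Hypothesis frel : forall u v, rel u v -> \prod_(a <- u) f a = \prod_(a <- v) f a.

Lemma cong_prod u v : cong u v -> \prod_(a <- u) f a = \prod_(a <- v) f a.
Proof.
elim=> {u v} [u v /frel//|a|a|//|u v _ -> //|u v w _ -> _ -> //|].
- by rewrite !big_cons big_nil mulg1 fV mulgV.
- by rewrite !big_cons big_nil mulg1 fV mulVg.
- by move=> u u' v v' _ uu' _ vv'; rewrite !big_cat /= uu' vv'.
Qed.

Definition pres_lift (x : presented) : K := \prod_(a <- pres_word x) f a.

Lemma pres_lift_class u : pres_lift (pres_class u) = \prod_(a <- u) f a.
Proof. exact/cong_prod/pres_class_word. Qed.

Lemma pres_lift_letter a : pres_lift (pres_letter a) = f a.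
Proof. by rewrite pres_lift_class big_cons big_nil mulg1. Qed.

Lemma pres_liftM : {morph pres_lift : x y / x * y}.
Proof.
move=> x y; rewrite -[x]pres_wordK -[y]pres_wordK -pres_class_cat.
by rewrite !pres_lift_class big_cat.
Qed.

End Lift.
End Presentation.

Section FreeGroup.
Variable n : nat.

Definition free_group :=
  presented (fun a : 'I_n * bool => (a.1, ~~ a.2)) (fun _ _ => False).
HB.instance Definition _ := Group.on free_group.

Definition free_gen (i : 'I_n) : free_group := pres_letter _ _ (i, true).

Lemma free_groupP (K : groupType) (f : 'I_n -> K) :
  exists h : {multiplicative free_group -> K},
    (forall i, h (free_gen i) = f i) /\
    forall h' : {multiplicative free_group -> K},
      (forall i, h' (free_gen i) = f i) -> h' =1 h.
Proof.
pose g (a : 'I_n * bool) := if a.2 then f a.1 else (f a.1)^-1.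
have gV a : g (a.1, ~~ a.2) = (g a)^-1 by case: a => i [] //=; rewrite invgK.
pose h := pres_lift g : free_group -> K.
have hM : {morph h : x y / x * y} by apply: pres_liftM.
pose mix := isMultiplicative.Build _ _ _ hM.
pose H : {multiplicative free_group -> K} := HB.pack h mix.
exists H; split=> [i|h' h'E x]; first exact: pres_lift_letter.
have h'1 : h' 1 = 1.
  by apply: (mulgI (h' 1)); rewrite -gmulfM !mulg1.
rewrite -[x]pres_wordK [RHS]pres_lift_class// pres_class_prod.
rewrite (big_morph h' (@gmulfM _ _ h') h'1).
apply: eq_bigr => -[i []] _ /=; first exact: h'E.
rewrite /g /= -(h'E i); apply: (mulIg (h' (free_gen i))).
rewrite mulVg -gmulfM -h'1; congr (h' _).
by rewrite /free_gen (pres_letterV _ _ (i, true)) mulVg.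
Qed.

End FreeGroup.

Section FreeProduct.
Variables G H : groupType.

Inductive fprod_rel : seq (G + H) -> seq (G + H) -> Prop :=
| fprod_rel1l : fprod_rel [:: inl 1] [::]
| fprod_rel1r : fprod_rel [:: inr 1] [::]
| fprod_relMl x y : fprod_rel [:: inl x; inl y] [:: inl (x * y)]
| fprod_relMr x y : fprod_rel [:: inr x; inr y] [:: inr (x * y)].

Definition fprod_inv (a : G + H) : G + H :=
  match a with inl x => inl x^-1 | inr y => inr y^-1 end.

Definition free_prod := presented fprod_inv fprod_rel.
HB.instance Definition _ := Group.on free_prod.

Definition fprod_inl (x : G) : free_prod := pres_letter _ _ (inl x).
Definition fprod_inr (y : H) : free_prod := pres_letter _ _ (inr y).

Lemma fprod_inlM : {morph fprod_inl : x y / x * y}.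
Proof.
move=> x y; rewrite -pres_class_cat.
exact/pres_classP/cong_sym/cong_rel/fprod_relMl.
Qed.

Lemma fprod_inrM : {morph fprod_inr : x y / x * y}.
Proof.
move=> x y; rewrite -pres_class_cat.
exact/pres_classP/cong_sym/cong_rel/fprod_relMr.
Qed.

HB.instance Definition _ := isMultiplicative.Build _ _ fprod_inl fprod_inlM.
HB.instance Definition _ := isMultiplicative.Build _ _ fprod_inr fprod_inrM.

Lemma free_prodP (K : groupType)
    (f : {multiplicative G -> K}) (g : {multiplicative H -> K}) :
  exists h : {multiplicative free_prod -> K},
    [/\ forall x, h (fprod_inl x) = f x, forall y, h (fprod_inr y) = g y &
      forall h' : {multiplicative free_prod -> K},
        (forall x, h' (fprod_inl x) = f x) ->
        (forall y, h' (fprod_inr y) = g y) -> h' =1 h].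
Proof.
have m1 (L M : groupType) (k : {multiplicative L -> M}) : k 1 = 1.
  by apply: (mulgI (k 1)); rewrite -gmulfM !mulg1.
have mV (L M : groupType) (k : {multiplicative L -> M}) x : k x^-1 = (k x)^-1.
  by apply: (mulIg (k x)); rewrite -gmulfM !mulVg m1.
pose k (a : G + H) := match a with inl x => f x | inr y => g y end.
have kV a : k (fprod_inv a) = (k a)^-1 by case: a => x /=; exact: mV.
have kr u v : fprod_rel u v -> \prod_(a <- u) k a = \prod_(a <- v) k a.
  by case=> [||x y|x y]; rewrite !(big_cons, big_nil) !mulg1 /= ?m1 ?gmulfM.
pose h := pres_lift k : free_prod -> K.
have hM : {morph h : x y / x * y} by apply: pres_liftM.
pose mix := isMultiplicative.Build _ _ _ hM.
pose hh : {multiplicative free_prod -> K} := HB.pack h mix.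
exists hh; split=> [x|y|h' hl hr x]; try exact: (pres_lift_letter kV kr).
rewrite -[x]pres_wordK [RHS](pres_lift_class kV kr) pres_class_prod.
rewrite (big_morph h' (@gmulfM _ _ h') (m1 _ _ h')).
by apply: eq_bigr => -[y|y] _; [exact: hl | exact: hr].
Qed.

Lemma fprod_inl_inj : injective fprod_inl.
Proof.
have oneM : {morph (fun _ : H => 1 : G) : x y / x * y}.
  by move=> x y; rewrite mulg1.
pose mix := isMultiplicative.Build _ _ _ oneM.
pose one : {multiplicative H -> G} := HB.pack (fun _ : H => 1 : G) mix.
have [h [hl _ _]] := free_prodP (@idfun G) one.
by move=> x y /(congr1 h); rewrite !hl.
Qed.

End FreeProduct.

Section Actions.
Variables (G : groupType) (Omega : Type).

Record is_action (act : G -> Omega -> Omega) : Prop := IsAction {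
  act1 : forall a, act 1 a = a;
  actM : forall g h a, act (g * h) a = act g (act h a) }.

Definition faithful_action (act : G -> Omega -> Omega) :=
  forall g, (forall a, act g a = a) -> g = 1.

(* The first component says that Omega has at least k elements. *)
Definition ktransitive (k : nat) (act : G -> Omega -> Omega) :=
  (exists a : 'I_k -> Omega, injective a) /\
  forall a b : 'I_k -> Omega, injective a -> injective b ->
    exists g, forall i, act g (a i) = b i.

End Actions.

Definition highly_transitive (G : groupType) :=
  exists (Omega : Type) (act : G -> Omega -> Omega),
    [/\ is_action act, faithful_action act & forall k, ktransitive k act].

(* Permutations of T, multiplied as functions: (s * t) x = s (t x). *)
Record sym (T : Type) := Sym {
  symf :> T -> T;
  symi : T -> T;
  symK : cancel symf symi;
  symVK : cancel symi symf }.

Section SymGroup.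
Variable T : Type.
Implicit Types s t : sym T.

HB.instance Definition _ := gen_eqMixin (sym T).
HB.instance Definition _ := gen_choiceMixin (sym T).

Lemma symP s t : s =1 t -> s = t.
Proof.
case: s t => [f f' fK f'K] [g g' gK g'K] /= /funext fg.
move: fK f'K gK g'K; rewrite fg => fK f'K gK g'K.
have E : f' = g' by apply/funext => x; rewrite -[in LHS](g'K x) fK.
by move: fK f'K; rewrite E => fK f'K; congr Sym; exact: Prop_irrelevance.
Qed.

Definition sym_one : sym T := @Sym T id id (frefl id) (frefl id).
Definition sym_mul s t : sym T :=
  Sym (can_comp (symK s) (symK t)) (can_comp (symVK t) (symVK s)).
Definition sym_inv s : sym T := Sym (symVK s) (symK s).

Lemma sym_mulA : associative sym_mul. Proof. by move=> s t u; exact: symP. Qed.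
Lemma sym_mul1 : left_id sym_one sym_mul. Proof. by move=> s; exact: symP. Qed.
Lemma sym_mulr1 : right_id sym_one sym_mul.
Proof. by move=> s; exact: symP. Qed.
Lemma sym_mulV : left_inverse sym_one sym_inv sym_mul.
Proof. by move=> s; apply: symP; exact: symK. Qed.
Lemma sym_mulrV : right_inverse sym_one sym_inv sym_mul.
Proof. by move=> s; apply: symP; exact: symVK. Qed.

HB.instance Definition _ := isGroup.Build (sym T)
  sym_mulA sym_mul1 sym_mulr1 sym_mulV sym_mulrV.

End SymGroup.

(* S is the support of s, and p is the permutation that s induces on S. *)
Definition even_finitary (s : sym nat) :=
  exists (S : {fset nat}) (p : {perm S}),
    [/\ forall x, (x \in S) = (s x != x), forall x : S, s (val x) = val (p x) &
        ~~ odd_perm p].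

Section EvenFinitary.
Implicit Types (s t : sym nat) (S T : {fset nat}).

Let acts_as T (q : {perm T}) s :=
  (forall x, x \notin T -> s x = x) /\ forall x : T, s (val x) = val (q x).

Let perm_extend S T (sST : (S `<=` T)%fset) (p : {perm S}) :
  exists q : {perm T}, [/\ odd_perm q = odd_perm p,
    forall x, q (fincl sST x) = fincl sST (p x) &
    forall y, val y \notin S -> q y = y].
Proof.
have [ts -> tsP] := prod_tpermP p.
elim: ts tsP => [_|[a b] ts IH /= /andP[ab /IH[q [qo qS qN]]]].
  by exists 1; split=> [|x|y _]; rewrite ?big_nil ?odd_perm1 ?perm1.
exists (tperm (fincl sST a) (fincl sST b) * q); split=> [|x|y yN].
- by rewrite big_cons !odd_mul_tperm qo (inj_eq (@fincl_inj _ _ _ sST)).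
- by rewrite big_cons !permM -inj_tperm ?qS //; exact: fincl_inj.
- by rewrite permM tpermD ?qN //; apply: contraNneq yN => <-; exact: fsvalP.
Qed.

Let acts_extend S T (p : {perm S}) s : (S `<=` T)%fset -> acts_as p s ->
  exists q : {perm T}, acts_as q s /\ odd_perm q = odd_perm p.
Proof.
move=> sST [pN pS]; have [q [qo qS qN]] := perm_extend sST p.
exists q; split=> //; split=> [x xT|x].
  by apply: pN; apply: contra xT; exact: (fsubsetP sST).
have [xS|xS] := boolP (val x \in S); last by rewrite qN // pN.
have -> : x = fincl sST [` xS]%fset by exact: val_inj.
by rewrite qS /= -pS.
Qed.

Lemma even_finitaryP s : even_finitary s <->
  exists T (q : {perm T}), acts_as q s /\ ~~ odd_perm q.
Proof.
split=> [[S [p [Sx pS po]]]|[T [q [[qN qT] qo]]]].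
  exists S, p; split=> //; split=> // x; rewrite Sx negbK.
  exact/eqP.
have sI : injective s := can_inj (symK s).
pose S := [fset x in T | s x != x]%fset.
have Sx x : (x \in S) = (s x != x).
  rewrite !inE /= andb_idl // => sx; apply: contraNT sx => /qN ->.
  exact: eqxx.
have sS x : x \in S -> s x \in S by rewrite !Sx (inj_eq sI).
pose f (x : S) : S := [` sS _ (valP x)]%fset.
have fI : injective f by move=> x y [] /sI /val_inj.
have pS : acts_as (perm fI) s.
  by split=> [x|x]; [rewrite Sx negbK => /eqP | rewrite permE].
have sST : (S `<=` T)%fset by apply/fsubsetP => x; rewrite !inE => /andP[].
have [q' [[_ q'T] q'o]] := acts_extend sST pS.
exists S, (perm fI); split; [exact: Sx | exact: pS.2 |].
rewrite -q'o; suff -> : q' = q by [].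
by apply/permP => x; apply: val_inj; rewrite -qT -q'T.
Qed.

Definition alt_pred : pred (sym nat) := fun s => `[< even_finitary s >].

Lemma alt_pred_closed : group_closed alt_pred.
Proof.
have V s : even_finitary s -> even_finitary s^-1.
  move=> [S [p [Sx pS po]]]; exists S, p^-1; split; last by rewrite odd_permV.
    by move=> x; rewrite Sx -(inj_eq (can_inj (symVK s))) (symK s) eq_sym.
  by move=> x; apply: (can_inj (symK s)); rewrite pS permKV symVK.
split=> [|s t /asboolP s_ev /asboolP /V t_ev]; apply/asboolP/even_finitaryP.
  by exists fset0, 1; rewrite odd_perm1; split=> //; split=> // x; rewrite perm1.
move: s_ev t_ev => /even_finitaryP[S [p [pS po]]] /even_finitaryP[T [q [qT qo]]].
have [p' [[p'N p'E] p'o]] := acts_extend (fsubsetUl S T) pS.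
have [q' [[q'N q'E] q'o]] := acts_extend (fsubsetUr S T) qT.
exists (S `|` T)%fset, (q' * p').
split; last by rewrite odd_permM p'o q'o negb_add (negbTE po) (negbTE qo).
split=> [x xN|x]; first by rewrite -[LHS]/(s (t^-1 x)) q'N // p'N.
by rewrite permM -p'E -q'E.
Qed.

End EvenFinitary.

Definition Alt_nat := {s : sym nat | alt_pred s}.
HB.instance Definition _ := SubChoice.on Alt_nat.
HB.instance Definition _ :=
  SubChoice_isSubGroup.Build (sym nat) alt_pred Alt_nat alt_pred_closed.

Section Conditions.
Variable G : groupType.

Definition normal_subgroup (N : set G) :=
  group_closed [in N] /\ forall x g, x \in N -> x ^ g \in N.

Definition contains_normal_copy (H : groupType) :=
  exists (N : set G) (f : {multiplicative H -> G}),
    [/\ normal_subgroup N, injective f & range f = N].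

(* The equation w = 1 is a mixed identity of G; w involves n variables. *)
Definition mixed_identity (n : nat) (w : free_prod G (free_group n)) :=
  forall f : {multiplicative free_prod G (free_group n) -> G},
    (forall g, f (fprod_inl _ g) = g) -> f w = 1.

Definition mixed_identity_free :=
  ~ exists (n : nat) (w : free_prod G (free_group n)),
      w <> 1 /\ mixed_identity w.

Record ggroup := GGroup {
  ggroup_group :> groupType;
  ggroup_emb : {multiplicative G -> ggroup_group};
  ggroup_emb_inj : injective ggroup_emb }.

Definition ggroup_self : ggroup := @GGroup G (@idfun G) (@inj_id G).

Definition ggroup_free_prod (H : groupType) : ggroup :=
  @GGroup (free_prod G H) (@fprod_inl G H) (@fprod_inl_inj G H).

Section Formulas.
Variable k : nat.

Inductive gterm :=
| Gvar of 'I_k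
| Gcst of G
| Gone
| Gmul of gterm & gterm
| Ginv of gterm.

(* Quantifier-free formulas in k free variables. *)
Inductive gformula :=
| Geq of gterm & gterm
| Gnot of gformula
| Gand of gformula & gformula
| Gor of gformula & gformula.

Variables (H : ggroup) (e : 'I_k -> H).

Fixpoint geval (t : gterm) : H :=
  match t with
  | Gvar i => e i
  | Gcst g => ggroup_emb H g
  | Gone => 1
  | Gmul t u => geval t * geval u
  | Ginv t => (geval t)^-1
  end.

Fixpoint gholds (phi : gformula) : Prop :=
  match phi with
  | Geq t u => geval t = geval u
  | Gnot phi => ~ gholds phi
  | Gand phi psi => gholds phi /\ gholds psi
  | Gor phi psi => gholds phi \/ gholds psi
  end.

End Formulas.

(* H satisfies the universal sentence forall x_0 ... x_(k-1), phi. *)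
Definition models_forall (k : nat) (phi : gformula k) (H : ggroup) :=
  forall e : 'I_k -> H, gholds e phi.

Definition universally_equivalent (H1 H2 : ggroup) :=
  forall (k : nat) (phi : gformula k),
    models_forall phi H1 <-> models_forall phi H2.

End Conditions.

(* Main.v *)
Require Import Defs.
From HB Require Import structures.
From mathcomp Require Import all_boot all_fingroup.
From mathcomp Require Import boolp classical_sets functions cardinality.
From mathcomp Require Import finmap.

Set Implicit Arguments.
Unset Strict Implicit.
Unset Printing Implicit Defensive.

Local Open Scope group_scope.

(** Let G act faithfully and highly transitively on an infinite countable set,
    which may as well be nat, so that G is a subgroup of Sym(nat) that is dense
    for pointwise convergence. Everything depends on whether some nontrivial
    element of G has finite support.

    If one does, say u, let h in G fix a point p moved by u and push the rest
    of the support of u away from it. The supports of u and of its conjugate by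
    h then meet in p only, so their commutator is a 3-cycle
    (commutator_3cycle). By 3-transitivity G contains all 3-cycles, hence all
    even finitary permutations (contains_even_finitary). These form a copy of
    Alt(nat), which is normal because it is normal in Sym(nat).

    If none does, every nontrivial w in G * F_n can be made nontrivial by
    substituting elements of G for the variables (separation). Write
    w = g_0 y_1 g_1 ... y_k g_k in reduced form, the y_j being variables or
    their inverses, and follow a point through w, choosing the values of the
    variables one point at a time. Since the coefficients that are not 1 have
    infinite support, each new point can be kept away from the finitely many
    points used so far; so no two choices conflict and the trajectory does not
    close up. Density of G then yields elements of G that make these choices.
    Finitely many words can be treated one after the other, so the retractions
    of G * F_n onto G discriminate G * F_n, and a universal sentence with
    constants in G holds in G * F_n as soon as it holds in G. Conversely
    universal equivalence excludes mixed identities, because w = 1 is itself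
    such a sentence (universally_equivalent_MIF).

    The two cases exclude each other. If N is a normal subgroup isomorphic to
    Alt(nat) and 1 <> a in N, then for b in N the support of a^b a is at most
    twice that of a, so (a^b a)^m = 1 for an m that depends on a only. For every
    x in G the element x a x^-1 is such a b, whence the mixed identity
    (a^(x a x^-1) a)^m = 1 of G (normal_Alt_nat_not_MIF). It is nontrivial
    because its left-hand side is a nonempty reduced word: such a word differs
    from 1 in G * F_n for every group G (reduced_neq1), by the same separation
    argument with Sym(G x nat) in place of G, where all nontrivial elements of
    G, acting by translations, have infinite support. *)

(** * Reduced words in a free product with a free group *)

Section GroupMorphisms.
Variables (G H : groupType) (f : {multiplicative G -> H}).

Lemma hom1 : f 1 = 1.
Proof. by apply: (mulgI (f 1)); rewrite -gmulfM !mulg1. Qed.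

Lemma homV x : f x^-1 = (f x)^-1.
Proof. by apply: (mulgI (f x)); rewrite -gmulfM !mulgV hom1. Qed.

Lemma homX m x : f (x ^+ m) = f x ^+ m.
Proof. by elim: m => [|m IH]; rewrite ?hom1 // !expgS gmulfM IH. Qed.

Lemma hom_prod I (r : seq I) (E : I -> G) :
  f (\prod_(i <- r) E i) = \prod_(i <- r) f (E i).
Proof. exact: (big_morph f (@gmulfM _ _ f) hom1). Qed.

End GroupMorphisms.

Definition opp_letter n (a : 'I_n * bool) := (a.1, ~~ a.2).

Definition letter_val n (K : groupType) (x : 'I_n -> K) (a : 'I_n * bool) : K :=
  if a.2 then x a.1 else (x a.1)^-1.

(** A word g_0 y_1 g_1 ... y_k g_k is split into its leading coefficient g_0
    and the list of pairs (y_j, g_j), on which inductions run; only the latter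
    is evaluated here. *)
Definition word_val n (G K : groupType) (phi : G -> K) (x : 'I_n -> K)
    (s : seq (('I_n * bool) * G)) : K :=
  \prod_(t <- s) (letter_val x t.1 * phi t.2).

(** Cancellation can occur only at a trivial coefficient between two inverse
    letters. *)
Definition reduced n (G : groupType) (s : seq (('I_n * bool) * G)) :=
  sorted (fun t u => (t.2 == 1) ==> (u.1 != opp_letter t.1)) s.

Definition variable (G : groupType) n (i : 'I_n) :
  free_prod G (free_group n) := fprod_inr G (free_gen i).

Lemma letter_valV n (K : groupType) (x : 'I_n -> K) a :
  letter_val x (opp_letter a) = (letter_val x a)^-1.
Proof. by case: a => i [] //=; rewrite /letter_val /= invgK. Qed.

Lemma fprod_inl1 (G H : groupType) : fprod_inl H (1 : G) = 1.
Proof. exact: (hom1 (@fprod_inl G H)). Qed.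

Section NormalForm.
Variables (G : groupType) (n : nat).
Local Notation F := (free_prod G (free_group n)).

Let has_form (w : F) := exists (g : G) (s : seq (('I_n * bool) * G)),
  reduced s /\ w = fprod_inl _ g * word_val (fprod_inl _) (@variable G n) s.

Let has_form_inl g w : has_form w -> has_form (fprod_inl _ g * w).
Proof.
move=> [h [s [rs ->]]]; exists (g * h), s; split=> //.
by rewrite fprod_inlM mulgA.
Qed.

(* The new letter is prepended unless it meets its inverse, across a trivial
   leading coefficient, in which case both disappear. *)
Let has_form_letter a w :
  has_form w -> has_form (letter_val (@variable G n) a * w).
Proof.
move=> [h [s [rs ->]]].
have long : reduced ((a, h) :: s) -> has_form (letter_val (@variable G n) a *
    (fprod_inl _ h * word_val (fprod_inl _) (@variable G n) s)).
  move=> rs'; exists 1, ((a, h) :: s); split=> //.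
  by rewrite fprod_inl1 mul1g /word_val big_cons mulgA.
case: s rs long => [|[b k] s] rs long; first by apply: long.
case: (boolP ((h == 1) ==> (b != opp_letter a))) => [ab|].
  by apply: long; rewrite /reduced /= ab.
rewrite negb_imply negbK => /andP[/eqP-> /eqP->].
exists k, s; split; first exact: path_sorted rs.
by rewrite fprod_inl1 mul1g /word_val big_cons /= letter_valV !mulgA mulgV mul1g.
Qed.

Lemma reduced_form w : has_form w.
Proof.
rewrite -[w]pres_wordK pres_class_prod.
elim: (pres_word w) => [|[g|y] u IH]; rewrite ?big_nil ?big_cons.
- exists 1, [::]; split=> //.
  by rewrite fprod_inl1 mul1g /word_val big_nil.
- exact: has_form_inl.
rewrite -/(fprod_inr G y) -[y]pres_wordK pres_class_prod hom_prod.
elim: (pres_word y) => [|a v IHv]; rewrite ?big_nil ?mul1g // big_cons -mulgA.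
rewrite [X in X * _](_ : _ = letter_val (@variable G n) a).
  exact: has_form_letter.
case: a => i [] //.
rewrite /letter_val /= /variable -homV; congr (fprod_inr G _).
exact: (pres_letterV _ _ (i, true)).
Qed.

End NormalForm.

Lemma retraction_exists (G K : groupType) (phi : {multiplicative G -> K}) n
    (x : 'I_n -> K) :
  exists f : {multiplicative free_prod G (free_group n) -> K},
    (forall g, f (fprod_inl _ g) = phi g) /\ (forall i, f (variable G i) = x i).
Proof.
have [h [hx _]] := free_groupP x.
have [f [fl fr _]] := free_prodP phi h.
by exists f; split=> // i; rewrite fr hx.
Qed.

Lemma gmulf_word (G K L : groupType) (phi : G -> K) (psi : G -> L) n
    (x : 'I_n -> K) (f : {multiplicative K -> L}) s :
  (forall g, f (phi g) = psi g) ->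
  f (word_val phi x s) = word_val psi (f \o x) s.
Proof.
move=> fphi; rewrite hom_prod; apply: eq_bigr => -[[i b] g] _ /=.
by rewrite gmulfM fphi /letter_val /=; case: b; rewrite ?homV.
Qed.

(** * Substitutions that keep words nontrivial *)

(** Density of the image of rho in Sym(T) for the topology of pointwise
    convergence; for an infinite T this is high transitivity. *)
Definition dense (K : groupType) (T : eqType) (rho : K -> sym T) :=
  forall l : seq (T * T), uniq (unzip1 l) -> uniq (unzip2 l) ->
    exists k, forall t, t \in l -> rho k t.1 = t.2.

Definition infinite_supports (G : groupType) (T : eqType) (phi : G -> sym T) :=
  forall g, g != 1 -> forall A : seq T, exists2 r, r \notin A & phi g r != r.

(** The values of the variables are chosen in K, and K acts on T through rho.
    Taking K apart from G serves two purposes: with K = G this treats the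
    retractions of G * F_n onto G, and with K = Sym(T) it shows that reduced
    words are nontrivial. *)
Section Walk.
Variables (G K : groupType) (T : eqType) (n : nat).
Variables (phi : {multiplicative G -> K}) (rho : {multiplicative K -> sym T}).
Hypothesis rho_dense : dense rho.
Hypothesis phi_supp : infinite_supports (rho \o phi).
Hypothesis Tinf : forall A : seq T, exists r, r \notin A.

Implicit Types (c : seq ('I_n * (T * T))) (x : 'I_n -> K).

(* A state c is a finite list of constraints: (i, (u, v)) requires the i-th
   variable to send u to v. *)
Let slice c i := [seq t.2 | t <- c & t.1 == i].
Let consistent c := forall i,
  uniq (unzip1 (slice c i)) && uniq (unzip2 (slice c i)).
Let obeys x c := forall t, t \in c -> rho (x t.1) t.2.1 = t.2.2.
(* The points that already have a prescribed preimage under the letter a *)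
Let targets c (a : 'I_n * bool) :=
  if a.2 then unzip2 (slice c a.1) else unzip1 (slice c a.1).
Let points c := unzip1 (unzip2 c) ++ unzip2 (unzip2 c).
Let edge (a : 'I_n * bool) (u v : T) : 'I_n * (T * T) :=
  (a.1, if a.2 then (u, v) else (v, u)).

Let realize c : consistent c -> exists x, obeys x c.
Proof.
move=> cc.
suff /choice[x xP] : forall i, exists k, forall t, t \in slice c i ->
    rho k t.1 = t.2.
  exists x => t tc; apply: xP; apply/mapP; exists t => //.
  by rewrite mem_filter eqxx.
by move=> i; have /andP[] := cc i; exact: rho_dense.
Qed.

Let targets_points c a u : u \notin points c -> u \notin targets c a.
Proof.
rewrite mem_cat negb_or => /andP[u1 u2].
have sub (f : T * T -> T) :
    u \notin map f (unzip2 c) -> u \notin map f (slice c a.1).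
  apply: contra => /mapP[t /mapP[t' + ->] ->]; rewrite mem_filter => /andP[_ ?].
  by do 2 apply: map_f.
by rewrite /targets; case: a.2; apply: sub.
Qed.

Let consistent_edge c a u v : consistent c -> u \notin targets c (opp_letter a) ->
  v \notin targets c a -> consistent (edge a u v :: c).
Proof.
move=> cc; case: a => i b ua va j; rewrite /slice /=.
case: eqP => [<-|_]; last exact: cc.
by case: b ua va => /= ua va; rewrite ua va /=; exact: cc.
Qed.

Let targets_edge c a u v b : targets (edge a u v :: c) b =
  if b.1 == a.1 then (if b.2 == a.2 then v else u) :: targets c b else targets c b.
Proof.
case: a b => [i e] [j f]; rewrite /targets /slice /= (eq_sym j).
by case: eqP => //= _; case: e; case: f.
Qed.

Let obeys_edge x c a u v : obeys x (edge a u v :: c) ->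
  rho (letter_val x a) u = v /\ obeys x c.
Proof.
move=> xc; split; last by move=> t tc; apply: xc; rewrite inE tc orbT.
have := xc (edge a u v); rewrite inE eqxx => /(_ isT).
rewrite /letter_val; case: a {xc} => i [] //= <-.
by rewrite -[LHS]/((rho (x i)^-1 * rho (x i)) v) -gmulfM mulVg hom1.
Qed.

(* The trajectory is built backwards, from the end point q of the whole word:
   the preimage r of q under the first letter is chosen fresh, and the walk goes
   on from its preimage under the next coefficient. This point may receive a
   preimage under the next letter: it is unused, except when the coefficient is
   1, and then the only constraint on it is the one just added, which a letter
   other than the inverse of the first does not meet. *)
Let walk s : reduced s -> forall c q (A : seq T), consistent c ->
  (if s is (a, _) :: _ then q \notin targets c a else q \notin A) ->
  exists c' p, [/\ consistent c', {subset c <= c'}, p \notin A &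
    forall x, obeys x c' -> rho (word_val phi x s) p = q].
Proof.
elim: s => [|[a g] s IH] rs c q A cc qA.
  exists c, q; split=> // x _; rewrite /word_val big_nil hom1 //.
pose B := q :: points c ++ A.
have [r rB rg] : exists2 r, (r \notin B) && (rho (phi g^-1) r \notin B) &
    (g == 1) || (rho (phi g^-1) r != r).
  have [->|g1] := eqVneq g 1.
    by have [r rB] := Tinf B; exists r => //; rewrite invg1 !hom1 /= rB.
  have [|r] := phi_supp (g := g^-1) _ (B ++ map (rho (phi g)) B).
    by rewrite invg_eq1.
  rewrite mem_cat negb_or => /andP[rB rgB] grr.
  exists r; last by apply/orP; right; exact: grr.
  rewrite rB; apply: contra rgB => rgB; apply/mapP.
  exists (rho (phi g^-1) r) => //.
  rewrite -[RHS]/((rho (phi g) * rho (phi g^-1)) r).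
  by rewrite -!gmulfM mulgV !hom1.
have notB z : z \notin B -> [/\ z != q, z \notin points c & z \notin A].
  by rewrite /B inE mem_cat !negb_or => /and3P[].
move: rB; set q' := rho (phi g^-1) r => /andP[/notB[rq rc rA] /notB[q'q q'c q'A]].
pose c1 := edge a r q :: c.
have cc1 : consistent c1.
  by apply: consistent_edge => //; exact: targets_points.
have [|c' [p [cc' cc1' pA xp]]] := IH (path_sorted rs) c1 q' A cc1.
  case: s {IH} rs => [_ //|[b h] s /= /andP[ab _]].
  rewrite targets_edge; case: ifP => [/eqP bi|_]; last exact: targets_points.
  rewrite inE (negbTE (targets_points _ q'c)) orbF.
  case: ifP => // bf; case/orP: rg => [g1|//].
  move: ab; rewrite g1 /= => /negP[].
  by case: a b bi bf {qA c1 cc1} => i [] [j []] //= -> .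
exists c', p; split=> // [t tc|x xc'].
  by apply: cc1'; rewrite /c1 inE tc orbT.
have [rx _] : rho (letter_val x a) r = q /\ obeys x c.
  by apply: obeys_edge => t tc; apply: xc'; apply: cc1'.
rewrite /word_val big_cons -/(word_val phi x s) !gmulfM /=.
rewrite -[LHS]/(rho (letter_val x a) (rho (phi g) (rho (word_val phi x s) p))) xp //.
rewrite /q' -[X in rho (letter_val x a) X]/((rho (phi g) * rho (phi g^-1)) r).
by rewrite -!gmulfM mulgV !hom1.
Qed.

(** Each word is given its own starting point, and its trajectory extends the
    state left by the others, so that one substitution serves all of them. *)
Lemma word_separation (l : seq (G * seq (('I_n * bool) * G))) :
  (forall t, t \in l -> reduced t.2 /\ (t.1 != 1) || (t.2 != [::])) ->
  exists x, forall t, t \in l -> phi t.1 * word_val phi x t.2 != 1.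
Proof.
move=> lP.
suff [c [/realize[x xc] cP]] : exists c, consistent c /\
    forall x, obeys x c -> forall t, t \in l -> phi t.1 * word_val phi x t.2 != 1.
  by exists x; exact: cP.
elim: l lP => [|[g s] l IH] lP; first by exists [::]; split.
have [t tl|c [cc cP]] := IH; first by apply: lP; rewrite inE tl orbT.
have [/= rs gs] := lP (g, s) (mem_head _ _).
pose u := rho (phi g).
(* The walk cannot avoid q = u q when the word is a mere coefficient, so a
   point moved by that coefficient is needed. *)
have [q [qA qu]] : exists q, q \notin points c /\ (s = [::] -> q != u q).
  have [g1|g1] := eqVneq g 1.
    have [q qA] := Tinf (points c); exists q; split=> // s0.
    by move: gs; rewrite g1 s0 eqxx.
  have [q qA qu] := phi_supp g1 (points c).
  by exists q; split=> // _; rewrite eq_sym.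
have [|c' [p [cc' sub pA xp]]] := walk rs (c := c) (q := q) (A := [:: u q]) cc.
  case: (s) qu => [/(_ erefl)|[a h] s' _]; first by rewrite inE.
  exact: targets_points.
exists c'; split=> // x xc' t; rewrite inE => /predU1P[->|]; last first.
  by apply: cP => t' t'c; apply: xc'; apply: sub.
apply: contraNneq pA => /(congr1 rho) e1.
have := congr1 (fun s : sym T => s p) e1.
by rewrite gmulfM hom1 inE /= -[LHS]/(u (rho (word_val phi x s) p)) xp // => ->.
Qed.

Lemma separation (ws : seq (free_prod G (free_group n))) :
  (forall w, w \in ws -> w != 1) ->
  exists f : {multiplicative free_prod G (free_group n) -> K},
    (forall g, f (fprod_inl _ g) = phi g) /\ forall w, w \in ws -> f w != 1.
Proof.
move=> ws1.
have /choice[F FP] : forall w : free_prod G (free_group n), exists t,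
    reduced t.2 /\ w = fprod_inl _ t.1 * word_val (fprod_inl _) (@variable G n) t.2.
  by move=> w; have [g [s H]] := reduced_form w; exists (g, s).
have [t /mapP[w /ws1 w1 ->]|x xP] := word_separation (l := map F ws).
  have [rF wF] := FP w; split=> //; apply: contraNT w1.
  rewrite negb_or !negbK => /andP[/eqP F1 /eqP F2].
  by rewrite wF F1 F2 fprod_inl1 mul1g /word_val big_nil.
have [f [fl fx]] := retraction_exists phi x.
exists f; split=> // w wws.
have [_ ->] := FP w; rewrite gmulfM fl (gmulf_word _ _ fl).
have -> : f \o @variable G n = x by apply/funext => i; exact: fx.
exact/xP/map_f.
Qed.

End Walk.

(** * Transpositions *)

Section Transpositions.
Variable T : eqType.
Implicit Types (a b c x : T) (s u v : sym T).

Let swap a b x := if x == a then b else if x == b then a else x.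

Let swapK a b : involutive (swap a b).
Proof.
move=> x; rewrite /swap; case: (eqVneq x a) => [->|xa].
  by rewrite eqxx; case: eqVneq.
by case: (eqVneq x b) => [->|xb]; rewrite ?eqxx // (negbTE xa) (negbTE xb).
Qed.

Definition transp a b : sym T := Defs.Sym (swapK a b) (swapK a b).

Lemma transpE a b x : transp a b x = if x == a then b else if x == b then a else x.
Proof. by []. Qed.

Lemma transpV a b : (transp a b)^-1 = transp a b.
Proof. exact: symP. Qed.

Lemma transpC a b : transp a b = transp b a.
Proof.
apply: symP => x; rewrite !transpE.
by case: eqVneq => // ->; case: eqVneq => // ->.
Qed.

Lemma transpK a b : transp a b * transp a b = 1.
Proof. by rewrite -{1}transpV mulVg. Qed.

Lemma transpJ s a b : transp a b ^ s = transp (s^-1 a) (s^-1 b).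
Proof.
apply: symP => x; rewrite -[LHS]/(s^-1 (transp a b (s x))) !transpE.
rewrite !(can2_eq (symK s) (symVK s)).
by case: ifP => // _; case: ifP => // _; exact: symK.
Qed.

(** A permutation that satisfies all constraints but one is corrected by a
    transposition, which moves no value prescribed before. *)
Lemma dense_sym : dense (@idfun (sym T)).
Proof.
elim=> [|[a b] l IH] /=; first by exists 1.
move=> /andP[a1 u1] /andP[b2 u2]; have [s sP] := IH u1 u2.
exists (transp (s a) b * s) => t.
rewrite inE -[_ t.1]/(transp (s a) b (s t.1)) transpE.
case/predU1P=> [->|tl] /=; first by rewrite eqxx.
rewrite sP // -(sP t tl) (inj_eq (can_inj (symK s))).
case: eqP a1 => [<-|_ _]; first by rewrite map_f.
by rewrite sP //; case: eqP b2 => // <-; rewrite map_f.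
Qed.

(** Off p and its two preimages, at most one of u and v acts on the points met
    along the commutator, and it is undone. *)
Lemma commutator_3cycle p u v : u p != p -> v p != p ->
    (forall x, x != p -> u x = x \/ v x = x) ->
  uniq [:: p; u^-1 p; v^-1 p] /\
  [~ u, v] = transp p (u^-1 p) * transp (u^-1 p) (v^-1 p).
Proof.
move=> up vp uv; have uI := can_inj (symK u); have vI := can_inj (symK v).
have uVI := can_inj (symVK u); have vVI := can_inj (symVK v).
have uV x : u x = x -> u^-1 x = x by move=> {1}<-; exact: (symK u).
have vV x : v x = x -> v^-1 x = x by move=> {1}<-; exact: (symK v).
have uVu x : u^-1 (u x) = x by exact: (symK u).
have vVv x : v^-1 (v x) = x by exact: (symK v).
have uuV x : u (u^-1 x) = x by exact: (symVK u).
have vvV x : v (v^-1 x) = x by exact: (symVK v).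
have upV : u^-1 p != p by rewrite -(inj_eq uI) uuV eq_sym.
have vpV : v^-1 p != p by rewrite -(inj_eq vI) vvV eq_sym.
have Cu x : u x != x -> x != p -> v x = x.
  by move=> + xp; case: (uv _ xp) => // ->; rewrite eqxx.
have Cv x : v x != x -> x != p -> u x = x.
  by move=> + xp; case: (uv _ xp) => // ->; rewrite eqxx.
have uvp : u (v p) = v p by apply: Cv => //; rewrite (inj_eq vI).
have vup : v (u p) = u p by apply: Cu => //; rewrite (inj_eq uI).
have vuVp : v (u^-1 p) = u^-1 p by apply: Cu => //; rewrite uuV eq_sym.
have uvVp : u (v^-1 p) = v^-1 p by apply: Cv => //; rewrite vvV eq_sym.
have uVvV : u^-1 p != v^-1 p.
  by apply: contraNneq vpV => E; rewrite -{1}uvVp -E uuV.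
split; first by rewrite /= !inE negb_or ![p == _]eq_sym upV vpV uVvV.
apply: symP => x; rewrite -[LHS]/(u^-1 (v^-1 (u (v x)))).
rewrite -[RHS]/(transp p (u^-1 p) (transp (u^-1 p) (v^-1 p) x)) !transpE.
have [->|xu] := eqVneq x (u^-1 p).
  by rewrite vuVp uuV (negbTE vpV) eq_sym (negbTE uVvV) uV.
have [->|xv] := eqVneq x (v^-1 p).
  by rewrite vvV (negbTE upV) eqxx vV // ?uVu.
have [->|xp] := eqVneq x p; first by rewrite uvp vVv.
rewrite (negbTE xu).
have [vx|vx] := eqVneq (v x) x.
  rewrite vx vV ?uVu //.
  have [->//|ux] := eqVneq (u x) x.
  apply: Cu; first by rewrite (inj_eq uI).
  by apply: contra xu => /eqP<-; rewrite uVu.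
have -> : u (v x) = v x.
  apply: Cv; first by rewrite (inj_eq vI).
  by apply: contra xv => /eqP<-; rewrite vVv.
by rewrite vVv uV //; apply: Cv.
Qed.

End Transpositions.

(** * Reduced words are nontrivial *)

Lemma large_nat (A : seq nat) : exists k, k \notin A.
Proof.
exists (\max_(i <- A) i).+1; apply/negP => kA.
by have := @leq_bigmax_seq _ A predT id _ kA isT; rewrite ltnn.
Qed.

Section Regular.
Variable G : groupType.

(* The second factor only serves to repeat the translation action infinitely
   often, so that nontrivial elements of a finite G have infinite support. *)
Let translate (g : G) (t : G * nat) := (g * t.1, t.2).
Let translateK g : cancel (translate g) (translate g^-1).
Proof. by move=> [h k]; rewrite /translate mulKg. Qed.
Let translateVK g : cancel (translate g^-1) (translate g).
Proof. by move=> [h k]; rewrite /translate mulVKg. Qed.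
Let regular (g : G) : sym (G * nat)%type := Defs.Sym (translateK g) (translateVK g).
Let regularM : {morph regular : g h / g * h}.
Proof. by move=> g h; apply: symP => -[x k] /=; rewrite /translate mulgA. Qed.

Lemma reduced_neq1 n (g : G) (s : seq (('I_n * bool) * G)) : reduced s ->
  s != [::] -> fprod_inl _ g * word_val (fprod_inl _) (@variable G n) s != 1.
Proof.
move=> rs s0.
pose mixr := isMultiplicative.Build _ _ _ regularM.
pose phi : {multiplicative G -> sym (G * nat)%type} := HB.pack regular mixr.
have Tinf (A : seq (G * nat)) : exists r, r \notin A.
  have [k kA] := large_nat (unzip2 A); exists (1, k).
  by apply: contra kA => kA; apply/mapP; exists (1, k).
have supp : infinite_supports (idfun \o phi).
  move=> h h1 A; have [k kA] := large_nat (unzip2 A); exists (1, k).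
    by apply: contra kA => kA; apply/mapP; exists (1, k).
  by apply: contra h1 => /eqP[]; rewrite mulg1 => ->.
have [|x xP] := word_separation (@dense_sym (G * nat)%type) supp Tinf (l := [:: (g, s)]).
  by move=> t; rewrite inE => /eqP->; rewrite s0 orbT.
have [f [fl fx]] := retraction_exists phi x.
apply: contraNneq (xP _ (mem_head _ _)) => /= w1.
rewrite -[X in _ == X](hom1 f) -w1 gmulfM fl (gmulf_word _ _ fl).
by have -> : f \o @variable G n = x by apply/funext => i; exact: fx.
Qed.

End Regular.

(** * Even finitary permutations *)

Lemma even_finitary1 : even_finitary 1.
Proof. by have [/asboolP] := alt_pred_closed. Qed.

Lemma even_finitaryM s t : even_finitary s -> even_finitary t -> even_finitary (s * t).
Proof.
move=> /asboolP s_ev /asboolP t_ev.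
exact/asboolP/(group_closedM alt_pred_closed).
Qed.

Lemma val_tperm (S : {fset nat}) (a b x : S) :
  val (tperm a b x) = transp (val a) (val b) (val x).
Proof.
rewrite transpE; case: tpermP => [->|->|/eqP + /eqP +] /=.
- by rewrite eqxx.
- by rewrite eqxx; case: eqP.
- by rewrite -!val_eqE /= => /negbTE -> /negbTE ->.
Qed.

Lemma even_finitary_transp2 a b c d : a != b -> c != d ->
  even_finitary (transp a b * transp c d).
Proof.
move=> ab cd; apply/even_finitaryP; pose S := [fset a; b; c; d]%fset.
have aS : a \in S by rewrite !inE eqxx.
have bS : b \in S by rewrite !inE eqxx orbT.
have cS : c \in S by rewrite !inE eqxx !orbT.
have dS : d \in S by rewrite !inE eqxx !orbT.
(* Products in {perm S} compose in the opposite order to those of sym. *)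
exists S, (tperm [` cS]%fset [` dS]%fset * tperm [` aS]%fset [` bS]%fset).
split; last by rewrite odd_permM !odd_tperm -!val_eqE /= ab cd.
split=> [x|x]; rewrite -[LHS]/(transp a b (transp c d _)) !transpE.
  rewrite !inE !negb_or -!andbA => /and4P[xa xb xc xd].
  by rewrite (negbTE xc) (negbTE xd) (negbTE xa) (negbTE xb).
by rewrite permM !val_tperm !transpE.
Qed.

(** Pairing off the factors of an even product of transpositions gives an
    induction principle that mentions neither supports nor signs. *)
Lemma even_finitary_ind (P : sym nat -> Prop) : P 1 ->
  (forall s a b c d, a != b -> c != d -> P s -> P (s * (transp a b * transp c d))) ->
  forall s, even_finitary s -> P s.
Proof.
move=> P1 PM s /even_finitaryP[S [q []]].
have [ts -> tsP] := prod_tpermP q; rewrite odd_perm_prod // => -[sN sS] ts_even.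
elim: {ts}(size ts) {-2}ts (leqnn (size ts)) ts_even tsP s sN sS => [|n IH] ts.
  rewrite leqn0 size_eq0 => /eqP-> _ _ s sN sS.
  suff -> : s = 1 by [].
  apply: symP => x; have [xS|/sN//] := boolP (x \in S).
  by have := sS [` xS]%fset; rewrite big_nil perm1.
case: ts => [|[c d] [|[a b] ts]] //; first by move=> _; exact: (IH [::]).
rewrite /= negbK ltnS => /ltnW ts_n ts_even /and3P[cd ab tsP] s sN sS.
pose r := s * (transp (val c) (val d) * transp (val a) (val b)).
have -> : s = r * (transp (val a) (val b) * transp (val c) (val d)).
  by rewrite /r !mulgA -(mulgA _ (transp (val a) _) (transp (val a) _)) transpK mulg1
    -mulgA transpK mulg1.
have rE x : r x = s (transp (val c) (val d) (transp (val a) (val b) x)) by [].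
have fixS (e f : S) x : x \notin S -> transp (val e) (val f) x = x.
  move=> xS; rewrite transpE.
  case: eqP => [xe|_]; first by rewrite xe fsvalP in xS.
  by case: eqP => // xf; rewrite xf fsvalP in xS.
apply: PM => //.
apply: (IH ts) => // [x xS|x]; first by rewrite rE !fixS // sN.
by rewrite rE -!val_tperm sS !big_cons !permM !tpermK.
Qed.

Lemma even_finitaryJ s t : even_finitary s -> even_finitary (s ^ t).
Proof.
move: s; apply: even_finitary_ind => [|s a b c d ab cd st].
  by rewrite conj1g; exact: even_finitary1.
rewrite !conjMg !transpJ; apply: even_finitaryM => //.
by apply: even_finitary_transp2; rewrite (inj_eq (can_inj (symVK t))).
Qed.

(** The order of a permutation of S divides that of Sym(S). *)
Lemma sym_exp_fact (S : {fset nat}) (s : sym nat) m :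
  (forall x, x \notin S -> s x = x) -> #|` S| <= m -> s ^+ m`! = 1.
Proof.
move=> sN Sm; have sI := can_inj (symK s).
have sS (x : S) : s (val x) \in S.
  by apply: contraLR (valP x) => sx; rewrite -(sI _ _ (sN _ sx)).
have pI : injective (fun x : S => [` sS x]%fset) by move=> x y [] /sI/val_inj.
pose p := perm pI.
have sp k x : (s ^+ k) (val x) = val ((p ^+ k) x).
  elim: k => [|k IH]; first by rewrite perm1.
  rewrite expgS expgSr permM permE /= -IH.
  by [].
have p1 : p ^+ m`! = 1.
  have : #[p] %| m`!.
    apply: (@dvdn_trans #|Sym [set: S]|%g).
      by apply: cardSg; rewrite cycle_subG inE; apply/fintype.subsetP => x; rewrite inE.
    by rewrite card_Sym cardsT -cardfE -(bin_fact Sm) dvdn_mull // dvdn_mulr.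
  by move=> /dvdnP[k ->]; rewrite mulnC expgnA expg_order expg1n.
have fixX k x : x \notin S -> (s ^+ k) x = x.
  move=> xS; elim: k => [//|k IH]; rewrite expgS -[LHS]/(s ((s ^+ k) x)) IH.
  exact: sN.
apply: symP => x; have [xS|/fixX->//] := boolP (x \in S).
by rewrite (sp _ [` xS]%fset) p1 perm1.
Qed.

(** * A normal copy of Alt(nat) produces a mixed identity *)

Section MixedIdentity.
Variable G : groupType.

Lemma word_val_flatten n (K : groupType) (phi : G -> K) (x : 'I_n -> K) s m :
  word_val phi x (flatten (nseq m s)) = word_val phi x s ^+ m.
Proof.
elim: m => [|m IH]; first by rewrite /word_val big_nil.
by rewrite expgS -IH /word_val /= big_cat.
Qed.

Lemma reduced_coef_neq1 n (s : seq (('I_n * bool) * G)) :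
  all (fun t => t.2 != 1) s -> reduced s.
Proof.
case: s => //= t s; elim: s t => //= u s IH t /and3P[/negbTE-> u1 s1].
by apply: IH; rewrite u1.
Qed.

Lemma Alt_nat_nontrivial : exists c : Alt_nat, c != 1.
Proof.
have ev : even_finitary (transp 0%N 1%N * transp 0%N 2%N) by exact: even_finitary_transp2.
pose c : Alt_nat := exist _ (transp 0%N 1%N * transp 0%N 2%N) (asboolT ev).
exists c; apply/eqP => /(congr1 (fun s : Alt_nat => val s 1%N)).
by [].
Qed.

(** The support of c^d has the same size as that of c, hence a bound for the
    support of the product which does not depend on d. *)
Lemma Alt_nat_conj_exponent (c : Alt_nat) : exists2 m, (0 < m)%N &
  forall d : Alt_nat, (c ^ d * c) ^+ m = 1.
Proof.
have /asboolP[S [p [Sx _ _]]] := valP c.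
exists (#|` S| + #|` S|)`! => [|d]; first exact: fact_gt0.
apply: val_inj; rewrite (homX (val : {multiplicative Alt_nat -> sym nat})).
apply: (@sym_exp_fact (S `|` [fset (val d)^-1 x | x in S])%fset).
  move=> x; rewrite in_fsetU negb_or => /andP[xS xdS].
  have cx : val c x = x by apply/eqP; rewrite -[_ == _]negbK -Sx.
  rewrite -[LHS]/((val d)^-1 (val c (val d (val c x)))) cx.
  have -> : val c (val d x) = val d x; last exact: symK.
  apply/eqP; rewrite -[_ == _]negbK -Sx; apply: contra xdS => dxS.
  by apply/imfsetP; exists (val d x) => //=; rewrite (symK (val d)).
apply: leq_trans (leq_card_fsetU _ _).1 _.
by rewrite leq_add2l leq_imfset_card.
Qed.

(** The identity must hold for all x in G, whereas the exponent bound concerns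
    conjugation by elements of N: so a is conjugated by x a x^-1, which lies
    in N for every x. *)
Lemma normal_Alt_nat_not_MIF : contains_normal_copy G Alt_nat ->
  ~ mixed_identity_free G.
Proof.
move=> [N [f [[_ NJ] fI fN]]]; apply.
have [c c1] := Alt_nat_nontrivial; have [m m_gt0 cm] := Alt_nat_conj_exponent c.
set a := f c; have a1 : a != 1 by rewrite -(hom1 f) (inj_eq fI).
(* For b = x a x^-1, the element a^b a is
   x a^-1 . x^-1 a . x a . x^-1 a. *)
pose x : 'I_1 * bool := (ord0, true).
pose s := [:: (x, a^-1); (opp_letter x, a); (x, a); (opp_letter x, a)].
exists 1%N, (word_val (fprod_inl _) (@variable G 1) (flatten (nseq m s))).
split.
  apply/eqP; have := @reduced_neq1 G 1 1 (flatten (nseq m s)).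
  rewrite fprod_inl1 mul1g; apply; last by case: (m) m_gt0.
  apply: reduced_coef_neq1; elim: (m) => //= k ->.
  by rewrite invg_eq1 a1.
move=> h hG; rewrite (gmulf_word _ _ hG) word_val_flatten.
set y := h \o _.
have /set_mem : a ^ (y ord0)^-1 \in N.
  by apply: NJ; rewrite -fN; apply/mem_set; exists c.
rewrite -fN => -[d _ fd].
have -> : word_val id y s = f (c ^ d * c).
  rewrite gmulfM conjgE !gmulfM homV fd -/a /word_val !big_cons big_nil.
  by rewrite /letter_val /= conjgE invgK !invMg !invgK !mulgA !mulg1.
by rewrite -homX cm hom1.
Qed.

End MixedIdentity.

(** * A finitary element produces a normal copy of Alt(nat) *)

Section FinitarySupport.
Variables (G : groupType) (rho : {multiplicative G -> sym nat}).
Hypothesis rho_dense : dense rho.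

Let H s := exists g, rho g = s.
Let HM s t : H s -> H t -> H (s * t).
Proof. by move=> [g <-] [h <-]; exists (g * h); rewrite gmulfM. Qed.
Let HV s : H s -> H s^-1.
Proof. by move=> [g <-]; exists g^-1; rewrite homV. Qed.
Let HJ s t : H s -> H t -> H (s ^ t).
Proof. by move=> Hs Ht; apply: (HM (HV Ht)); apply: HM. Qed.

(** Conjugation by an element that fixes one point of the support of u and
    moves the other ones out of it gives a permutation whose support meets that
    of u in this point only. *)
Lemma contains_3cycle u (A : seq nat) : H u -> u != 1 ->
    (forall x, x \notin A -> u x = x) ->
  exists p q r, uniq [:: p; q; r] /\ H (transp p q * transp q r).
Proof.
move=> Hu u1 uA.
have [p up] : exists p, u p != p.
  apply/not_existsP => up; case/eqP: u1; apply: symP => x.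
  by have /negP/negPn/eqP := up x.
have pA : p \in A by apply: contraNT up => /uA->.
(* Adding M moves any point outside A. *)
pose M := (\max_(i <- A) i).+1.
have AM x : x \in A -> (x < M)%N.
  by move=> xA; rewrite ltnS; exact: (@leq_bigmax_seq _ A predT id).
pose A' := [seq x <- undup A | x != p].
pose l := (p, p) :: [seq (x, (M + x)%N) | x <- A'].
have [||h hl] := rho_dense (l := l).
- rewrite /unzip1 /= -map_comp map_id_in // mem_filter eqxx /=.
  by rewrite filter_uniq ?undup_uniq.
- rewrite /unzip2 /= -map_comp map_inj_uniq; last by move=> x y /addnI.
  rewrite filter_uniq ?undup_uniq // andbT; apply/mapP => -[x _ pE].
  by have := AM p pA; rewrite pE ltnNge leq_addr.
have hp : rho h p = p by apply: (hl (p, p)); rewrite inE eqxx.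
have hA x : x \in A -> x != p -> rho h x \notin A.
  move=> xA xp; rewrite (hl (x, (M + x)%N)); last first.
    by rewrite inE; apply/orP; right; apply: map_f; rewrite mem_filter xp mem_undup.
  by apply/negP => /AM /=; rewrite ltnNge leq_addr.
pose v := u ^ (rho h)^-1.
have hI := can_inj (symK (rho h)).
have vh x : v (rho h x) = rho h (u x).
  rewrite -[LHS]/((rho h)^-1^-1 (u ((rho h)^-1 (rho h x)))) invgK.
  by rewrite (symK (rho h) x : (rho h)^-1 (rho h x) = x).
have Hv : H v by apply: HJ => //; apply: HV; exists h.
have vp : v p != p by rewrite -{1}hp vh -{2}hp (inj_eq hI).
have uv x : x != p -> u x = x \/ v x = x.
  move=> xp; have [->|ux] := eqVneq (u x) x; [by left | right].
  have xA : x \in A by apply: contraNT ux => /uA->.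
  have xE : x = rho h ((rho h)^-1 x) by rewrite [RHS](symVK (rho h)).
  move: xp xA; rewrite {}xE; move: ((rho h)^-1 x) => y {ux} yp hyA.
  rewrite vh; congr (rho h _); apply: uA.
  apply: contraL hyA => yA; apply: hA => //.
  by apply: contra yp => /eqP->; rewrite hp.
have [un E] := commutator_3cycle up vp uv.
exists p, (u^-1 p), (v^-1 p); split=> //; rewrite -E commgEl.
by apply: HM; [exact: HV | exact: HJ].
Qed.

(** The products of two transpositions that share a point are 3-cycles or 1;
    the remaining ones reduce to them by
    (a b)(c d) = (a b)(b c) . (b c)(c d). *)
Lemma contains_even_finitary u (A : seq nat) : H u -> u != 1 ->
    (forall x, x \notin A -> u x = x) ->
  forall s, even_finitary s -> H s.
Proof.
move=> Hu u1 uA; have [p [q [r [un Hpqr]]]] := contains_3cycle Hu u1 uA.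
have H1 : H 1 by exists 1; exact: hom1.
have H3 a b c : a != b -> b != c -> H (transp a b * transp b c).
  move=> ab bc; have [->|ac] := eqVneq a c; first by rewrite (transpC b) transpK.
  have [||h hl] := rho_dense (l := [:: (a, p); (b, q); (c, r)]) => //=.
    by rewrite !inE negb_or ab ac bc.
  have hE x y : (x, y) \in [:: (a, p); (b, q); (c, r)] -> (rho h)^-1 y = x.
    by move=> /hl /= <-; exact: symK.
  have := HJ Hpqr (ex_intro _ h erefl : H (rho h)).
  by rewrite conjMg !transpJ (hE a p) ?(hE b q) ?(hE c r) ?inE ?eqxx ?orbT.
apply: even_finitary_ind => // s a b c d ab cd Hs; apply: HM => //.
case: (eqVneq b c) cd => [<- bd|bc cd]; first exact: H3.
have -> : transp a b * transp c d =
    (transp a b * transp b c) * (transp b c * transp c d).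
  by rewrite mulgA -(mulgA (transp a b)) transpK mulg1.
by apply: HM; apply: H3.
Qed.

Hypothesis rho_inj : injective rho.

Lemma contains_normal_Alt_nat u (A : seq nat) : H u -> u != 1 ->
    (forall x, x \notin A -> u x = x) ->
  contains_normal_copy G Alt_nat.
Proof.
move=> Hu u1 uA.
have /choice[f fE] : forall s : Alt_nat, H (val s).
  by move=> s; apply: (contains_even_finitary Hu u1 uA); apply/asboolP/(valP s).
have fM : {morph f : s t / s * t}.
  by move=> s t; apply: rho_inj; rewrite gmulfM !fE.
pose mix := isMultiplicative.Build _ _ _ fM.
pose F : {multiplicative Alt_nat -> G} := HB.pack f mix.
pose N : set G := [set g | even_finitary (rho g)]%classic.
have ND g h : even_finitary (rho g) -> even_finitary (rho h) ->
    even_finitary (rho (g * h^-1)).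
  move=> /asboolP g_ev /asboolP h_ev; rewrite gmulfM homV.
  by apply/asboolP; apply: alt_pred_closed.2.
exists N, F; split.
- split=> [|x g /set_mem xN]; last first.
    apply/mem_set; rewrite /N /= conjgE !gmulfM homV.
    exact: even_finitaryJ.
  split; first by apply/mem_set; rewrite /N /= hom1; exact: even_finitary1.
  by move=> g h /set_mem gN /set_mem hN; apply/mem_set; exact: ND.
- by move=> s t /(congr1 rho); rewrite !fE => /val_inj.
- apply/seteqP; split=> [_ [s _ <-]|g gN].
    by rewrite /N /= fE; apply/asboolP/(valP s).
  exists (exist _ (rho g) (asboolT gN)) => //.
  by apply: rho_inj; rewrite fE.
Qed.

End FinitarySupport.

(** * Universal equivalence *)

Section UniversalEquivalence.
Variable G : groupType.

(** An equation holds exactly when the corresponding quotient is 1, so a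
    homomorphism that kills none of the nontrivial quotients preserves the
    truth value of the formula. *)
Fixpoint atoms k (H : ggroup G) (e : 'I_k -> H) (phi : gformula G k) : seq H :=
  match phi with
  | Geq t u => [:: geval e t * (geval e u)^-1]
  | Gnot phi => atoms e phi
  | Gand phi psi | Gor phi psi => atoms e phi ++ atoms e psi
  end.

Lemma geval_hom k (H1 H2 : ggroup G) (f : {multiplicative H1 -> H2})
    (e : 'I_k -> H1) t :
  (forall g, f (ggroup_emb H1 g) = ggroup_emb H2 g) ->
  geval (f \o e) t = f (geval e t).
Proof.
move=> fG; elim: t => //=; first by rewrite hom1.
  by move=> t -> u ->; rewrite gmulfM.
by move=> t ->; rewrite homV.
Qed.

Lemma gholds_hom k (H1 H2 : ggroup G) (f : {multiplicative H1 -> H2})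
    (e : 'I_k -> H1) phi :
  (forall g, f (ggroup_emb H1 g) = ggroup_emb H2 g) ->
  (forall w, w \in atoms e phi -> f w = 1 -> w = 1) ->
  gholds (f \o e) phi <-> gholds e phi.
Proof.
move=> fG; elim: phi => /=.
- move=> t u /(_ _ (mem_head _ _)) f1; rewrite !geval_hom //; split=> [E|-> //].
  by apply/divg1_eq/f1; rewrite gmulfM homV E mulgV.
- by move=> phi IH /IH ->.
- move=> phi IHphi psi IHpsi f1; rewrite IHphi ?IHpsi // => w wphi.
    by apply: f1; rewrite mem_cat wphi orbT.
  by apply: f1; rewrite mem_cat wphi.
- move=> phi IHphi psi IHpsi f1; rewrite IHphi ?IHpsi // => w wphi.
    by apply: f1; rewrite mem_cat wphi orbT.
  by apply: f1; rewrite mem_cat wphi.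
Qed.

(** A counterexample in G * F_n involves finitely many nontrivial elements,
    and a retraction that kills none of them carries it to G. The other
    direction holds because universal sentences pass to substructures. *)
Lemma discriminated_equivalent n :
  (forall ws : seq (free_prod G (free_group n)),
    (forall w, w \in ws -> w != 1) ->
    exists f : {multiplicative free_prod G (free_group n) -> G},
      (forall g, f (fprod_inl _ g) = g) /\ forall w, w \in ws -> f w != 1) ->
  universally_equivalent (ggroup_self G) (ggroup_free_prod G (free_group n)).
Proof.
move=> sep k phi; split=> [phiG e|phiF e].
  have [w|f [fG f1]] :=
    sep [seq w <- atoms (H := ggroup_free_prod G (free_group n)) e phi | w != 1].
    by rewrite mem_filter => /andP[].
  apply/(gholds_hom (H1 := ggroup_free_prod G _) (H2 := ggroup_self G) (f := f)).
  - exact: fG.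
  - move=> w wphi fw; apply/eqP; apply: contraT => w1.
    by have := f1 w; rewrite mem_filter w1 wphi fw eqxx => /(_ isT).
  - exact: phiG.
have := phiF (@fprod_inl G (free_group n) \o e).
apply: (gholds_hom (H1 := ggroup_self G) (H2 := ggroup_free_prod G _)
  (f := @fprod_inl G _) _ _).1.
- by [].
- by move=> w _ w1; apply: (@fprod_inl_inj G (free_group n)); rewrite w1 hom1.
Qed.

Fixpoint word_term n (s : seq (('I_n * bool) * G)) : gterm G n :=
  if s is (a, g) :: s' then
    let y := if a.2 then Gvar _ a.1 else Ginv (Gvar _ a.1) in
    Gmul (Gmul y (Gcst _ g)) (word_term s')
  else Gone _ _.

Lemma geval_word n (H : ggroup G) (e : 'I_n -> H) s :
  geval e (word_term s) = word_val (ggroup_emb H) e s.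
Proof.
elim: s => [|[[i b] g] s IH] /=; rewrite /word_val ?big_nil // big_cons IH.
by case: b.
Qed.

(** The sentence that w is 1 for all values of the variables holds in G when
    w is a mixed identity; evaluated at the variables themselves, it says
    w = 1. *)
Lemma universally_equivalent_MIF :
  (forall n, universally_equivalent (ggroup_self G)
     (ggroup_free_prod G (free_group n))) -> mixed_identity_free G.
Proof.
move=> equiv [n [w [w1 wmix]]]; apply: w1.
have [g [s [_ wE]]] := reduced_form w.
pose phi := Geq (Gmul (Gcst n g) (word_term s)) (Gone G n).
have phiG : models_forall phi (ggroup_self G).
  move=> e; have [f [fG fx]] := retraction_exists (@idfun G) e.
  rewrite /= geval_word -(wmix f fG) wE gmulfM fG (gmulf_word _ _ fG).
  by have -> : f \o @variable G n = e by apply/funext.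
have := (equiv n n phi).1 phiG (@variable G n).
by rewrite /= geval_word -wE.
Qed.

End UniversalEquivalence.

(** * The dichotomy *)

(** An orbit of a countable group is countable, and a set on which k-tuples of
    distinct points exist for all k is infinite. *)
Lemma nat_action (G : groupType) : countable [set: G]%classic ->
  highly_transitive G ->
  exists rho : {multiplicative G -> sym nat}, injective rho /\ dense rho.
Proof.
move=> Gc [Omega [act [[act1 actM] act_faith act_ht]]].
have Oinf : infinite_set [set: Omega]%classic.
  move=> /finite_setP[n] /card_eqPle[/pcard_leP[f] _].
  have [[a aI] _] := act_ht n.+1.
  have fn i : (f (a i) < n)%N by exact: (@funS _ _ _ _ f (a i)).
  have fI : injective (fun i => Ordinal (fn i)).
    by move=> i j [] /(@inj _ _ _ f) ij; apply/aI/ij; exact/mem_set.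
  by have := leq_card _ fI; rewrite !card_ord ltnn.
have Oc : countable [set: Omega]%classic.
  have [[o _] tr] := act_ht 1%N; pose p := o ord0.
  have -> : [set: Omega]%classic = [set act g p | g in [set: G]]%classic.
    apply/seteqP; split=> // q _.
    have [||g gp] := tr (fun=> p) (fun=> q); try by move=> i j _; rewrite !ord1.
    by exists g => //; exact: (gp ord0).
  exact: sub_countable (card_image_le _ _) Gc.
have /pcard_eqP[e] := eq_card_nat Oc Oinf.
have [code codeK decodeK] : bijective e by rewrite -setTT_bijective; exact: bij.
have decK g : cancel (fun i => e (act g (code i))) (fun i => e (act g^-1 (code i))).
  by move=> i; rewrite codeK -actM mulVg act1 decodeK.
have decVK g : cancel (fun i => e (act g^-1 (code i))) (fun i => e (act g (code i))).
  by move=> i; rewrite codeK -actM mulgV act1 decodeK.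
pose r g : sym nat := Defs.Sym (decK g) (decVK g).
have rM : {morph r : g h / g * h}.
  by move=> g h; apply: symP => i /=; rewrite codeK actM.
pose mix := isMultiplicative.Build _ _ _ rM.
pose rho : {multiplicative G -> sym nat} := HB.pack r mix.
exists rho; split.
  move=> g h gh; apply/(mulIg h^-1); rewrite mulgV; apply: act_faith => p.
  have := congr1 (fun s : sym nat => s (e (act h^-1 p))) gh.
  by rewrite /= !codeK -!actM mulgV act1 => /(can_inj codeK).
move=> l u1 u2; pose k := size l.
have [||g gl] := (act_ht k).2 (fun i : 'I_k => code (nth 0%N (unzip1 l) i))
    (fun i => code (nth 0%N (unzip2 l) i)).
- move=> i j /(can_inj decodeK) /eqP; rewrite nth_uniq ?size_map //.
  by move=> /eqP/val_inj.
- move=> i j /(can_inj decodeK) /eqP; rewrite nth_uniq ?size_map //.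
  by move=> /eqP/val_inj.
exists g => t tl; rewrite -index_mem in tl.
have /= := gl (Ordinal tl).
rewrite !(nth_map (0%N, 0%N)) // nth_index -?index_mem // => gt.
by rewrite /= gt decodeK.
Qed.

Theorem theorem1p6 (G : groupType) (Gcount : countable [set: G]%classic)
    (Ght : highly_transitive G) :
  ((contains_normal_copy G Alt_nat /\ ~ mixed_identity_free G) \/
   (~ contains_normal_copy G Alt_nat /\ mixed_identity_free G)) /\
  (mixed_identity_free G <->
   forall n : nat, universally_equivalent
     (ggroup_self G) (ggroup_free_prod G (free_group n))).
Proof.
have [rho [rho_inj rho_dense]] := nat_action Gcount Ght.
have dichotomy : contains_normal_copy G Alt_nat \/
    forall n, universally_equivalent (ggroup_self G)
      (ggroup_free_prod G (free_group n)).
  have [supp|nosupp] := pselect (infinite_supports rho).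
    right=> n; apply: discriminated_equivalent => ws ws1.
    exact: (separation (phi := @idfun G) rho_dense supp large_nat ws1).
  left; apply: contrapT => noAlt; apply: nosupp => g g1 A; apply: contrapT => fin.
  apply: noAlt; apply: (contains_normal_Alt_nat rho_dense rho_inj (u := rho g) (A := A)).
  - by exists g.
  - by rewrite -(hom1 rho) (inj_eq rho_inj).
  - move=> x xA; apply/eqP; apply: contraT => gx; case: fin.
    by exists x.
have notMIF := @normal_Alt_nat_not_MIF G.
have MIF := @universally_equivalent_MIF G.
split; last by split=> // mif; case: dichotomy => // /notMIF.
case: dichotomy => [alt|equiv]; [left | right]; split=> //; first exact: notMIF.
  by move=> /notMIF; apply; exact: MIF.
exact: MIF.
Qed.
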